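(* (Soundness of $\mathrm{QHL}_d$.) For all deterministic assertions $\phi,\psi$ and every command $C$: if $\vdash\{\phi\}C\{\psi\}$ is derivable in the proof system $\mathrm{QHL}_d$, then $\models\{\phi\}C\{\psi\}$.
   Context: Setting. Fix a set $\mathbb{PV}$ of classical program variables ($X,Y,\dots$), a set $\mathbb{LV}$ of logical variables ($x,y,\dots$) and a finite set $\{q_1,\dots,q_m\}$ of quantum variables; each $q_i$ has a 2-dimensional Hilbert space $\mathcal H_i$ and $\mathcal H=\mathcal H_1\otimes\cdots\otimes\mathcal H_m$. Arithmetic expressions: $E::=n\mid X\mid (E\ aop\ E)$ ($n\in\mathbb Z$, $aop$ an integer operation such as $+,-,\times$). Boolean expressions: $B::=\top\mid\bot\mid(E\ rop\ E)\mid\neg B\mid(B\wedge B)$ ($rop$ an integer relation such as $<,>,\ge,=$). A classical state is $S:\mathbb{PV}\to\mathbb Z$, and $[\![E]\!]S$, $[\![B]\!]S$ are defined compositionally. A quantum state is a unit vector of $\mathcal H$ (vectors differing by a global phase are identified). A pure cq-state is a pair $\theta=(\theta_c,\theta_q)$ of a classical state and a quantum state; $\mathbb{PS}$ is the set of pure cq-states. A probabilistic cq-state is $\Theta:\mathbb{PS}\to[0,1]$ with $\sum_\theta\Theta(\theta)\le1$; $sp(\Theta)=\{\theta:\Theta(\theta)>0\}$; $\widehat\theta$ is the point distribution at $\theta$. $\downarrow_B(\Theta)(\theta)=\Theta(\theta)$ if $[\![B]\!]\theta_c=\top$ and $0$ otherwise. Commands: $C::=skip\mid X\leftarrow E\mid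 X\xleftarrow{\$}\{a_1:k_1,\dots,a_n:k_n\}\mid C_1;C_2\mid if\ B\ then\ C_1\ else\ C_2\mid while\ B\ do\ C\mid U[\overline q]\mid X\leftleftarrows q_i$, where $k_i\in\mathbb Z$, $0<a_i<1$, $\sum a_i=1$, and $U$ is a unitary acting on the qubits $\overline q$ ($U_{\overline q}$ denotes $U$ on $\overline q$ tensored with the identity). Semantics $[\![C]\!]$ maps probabilistic cq-states to probabilistic cq-states: $[\![skip]\!]\Theta=\Theta$; $[\![X\leftarrow E]\!]\widehat\theta=\widehat{(\theta_c[X\mapsto[\![E]\!]\theta_c],\theta_q)}$; $[\![X\xleftarrow{\$}\{a_i:k_i\}]\!]\Theta=\sum_i a_i[\![X\leftarrow k_i]\!]\Theta$; $[\![C_1;C_2]\!]=[\![C_2]\!]\circ[\![C_1]\!]$; $[\![if\ B\ then\ C_1\ else\ C_2]\!]\Theta=[\![C_1]\!](\downarrow_B\Theta)+[\![C_2]\!](\downarrow_{\neg B}\Theta)$; $[\![while\ B\ do\ C]\!]\Theta=\sum_{i\ge0}\downarrow_{\neg B}(([\![C]\!]\circ\downarrow_B)^i\Theta)$; $[\![U[\overline q]]\!]\widehat\theta=\widehat{(\theta_c,U_{\overline q}\theta_q)}$; $[\![X\leftleftarrows q_i]\!]\widehat\theta=\sum_{j\in\{0,1\}}p_j\widehat{\theta_j}$ with $p_j=\mathrm{Tr}((|j\rangle\langle j|\otimes I_{-i})\theta_q\theta_q^\dagger)$ (projector on $q_i$), $\theta_{j,c}=\theta_c[X\mapsto j]$,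 $\theta_{j,q}=(|j\rangle\langle j|\otimes I_{-i})\theta_q/\sqrt{p_j}$ (if $p_j=0$ the term has weight 0). Assignment, unitary and measurement are extended to arbitrary $\Theta$ linearly: $[\![C]\!]\Theta=\sum_\theta\Theta(\theta)[\![C]\!]\widehat\theta$. Deterministic assertions: $\phi::=\top\mid\bot\mid P^0_j\mid P^1_j\mid(e\ rop\ e)\mid\neg\phi\mid(\phi\wedge\phi)\mid\forall x\phi\mid[U_{\overline q}]\phi\mid[\mathfrak P^0_j]\phi\mid[\mathfrak P^1_j]\phi\mid\bigwedge_{i=0}^\infty\phi_i$, with $e::=n\mid X\mid x\mid(e\ aop\ e)$; $\vee,\to$ are the usual abbreviations; Boolean expressions are regarded as assertions. An interpretation is $I:\mathbb{LV}\to\mathbb Z$; $[\![e]\!]^I\theta$ evaluates $X$ as $\theta_c(X)$ and $x$ as $I(x)$. Satisfaction $\theta\models^I\phi$: $\top$ always, $\bot$ never; $P^i_j$ iff $\mathrm{Tr}(|i\rangle\langle i|\,\mathrm{Tr}_{-j}(\theta_q\theta_q^\dagger))=1$ ($\mathrm{Tr}_{-j}$ the partial trace over all qubits but $q_j$); $e_1\ rop\ e_2$ iff $[\![e_1]\!]^I\theta\ rop\ [\![e_2]\!]^I\theta$; $\neg,\wedge,\bigwedge$ classically; $\forall x\phi$ iff $\theta\models^{I[x\mapsto n]}\phi$ for all $n\in\mathbb Z$; $[U_{\overline q}]\phi$ iff $(\theta_c,U_{\overline q}\theta_q)\models^I\phi$; $[\mathfrak P^i_j]\phi$ iff $p_i:=\mathrm{Tr}((|i\rangle\langle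 i|_j\otimes I_{-j})\theta_q\theta_q^\dagger)>0$ and $(\theta_c,(|i\rangle\langle i|_j\otimes I_{-j})\theta_q/\sqrt{p_i})\models^I\phi$. For probabilistic $\Theta$: $\Theta\models^I\phi$ iff $\theta\models^I\phi$ for every $\theta\in sp(\Theta)$. $\phi[X/E]$ is substitution of $E$ for the program variable $X$. $\models\phi\to\psi$ means $\theta\models^I\phi$ implies $\theta\models^I\psi$ for all $I,\theta$. $\models\{\phi\}C\{\psi\}$ means: for every interpretation $I$ and pure cq-state $\theta$, $\theta\models^I\phi$ implies $[\![C]\!](\widehat\theta)\models^I\psi$. Proof system $\mathrm{QHL}_d$ (derivability $\vdash\{\phi\}C\{\psi\}$): SKIP $\vdash\{\phi\}skip\{\phi\}$; AS $\vdash\{\phi[X/E]\}X\leftarrow E\{\phi\}$; PAS $\vdash\{\phi[X/k_1]\wedge\cdots\wedge\phi[X/k_n]\}X\xleftarrow{\$}\{a_1:k_1,\dots,a_n:k_n\}\{\phi\}$; SEQ from $\vdash\{\phi\}C_1\{\phi_1\}$ and $\vdash\{\phi_1\}C_2\{\phi_2\}$ infer $\vdash\{\phi\}C_1;C_2\{\phi_2\}$; IF from $\vdash\{\phi\wedge B\}C_1\{\psi\}$ and $\vdash\{\phi\wedge\neg B\}C_2\{\psi\}$ infer $\vdash\{\phi\}if\ B\ then\ C_1\ else\ C_2\{\psi\}$; WHILE from $\vdash\{\phi\wedge B\}C\{\phi\}$ infer $\vdash\{\phi\}while\ B\ do\ C\{\phi\wedge\neg B\}$; UNITARY $\vdash\{[U_{\overline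 q}]\phi\}U[\overline q]\{\phi\}$; MEASURE $\vdash\{([\mathfrak P^0_j]\phi[X/0]\vee P^1_j)\wedge([\mathfrak P^1_j]\phi[X/1]\vee P^0_j)\}X\leftleftarrows q_j\{\phi\}$; CONS from $\models\phi'\to\phi$, $\vdash\{\phi\}C\{\psi\}$, $\models\psi\to\psi'$ infer $\vdash\{\phi'\}C\{\psi'\}$. *)

(* Defs.v *)
From HB Require Import structures.
From mathcomp Require Import all_boot all_order all_algebra.
From mathcomp Require Import complex.
From mathcomp Require Import boolp classical_sets reals ereal topology normedtype sequences esum.

Set Implicit Arguments.
Unset Strict Implicit.
Unset Printing Implicit Defensive.

Import Order.TTheory GRing.Theory Num.Theory.

Local Open Scope ring_scope.
Local Open Scope sesquilinear_scope.
Local Open Scope quotient_scope.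
Local Open Scope complex_scope.

(* Computational basis of n qubits; the Hilbert space (C^2)^(tensor n) is
   'cV_(hdim n), with coordinates indexed by basis states through enum_rank. *)
Notation basis n := {ffun 'I_n -> 'I_2}.
Notation hdim n := #|{: basis n}|.

Section LocalOperators.
Variables (C : numClosedFieldType) (m k : nat) (qs : k.-tuple 'I_m).

Definition local_state (b : basis m) : basis k := [ffun l => b (tnth qs l)].

Definition agree_off (b b' : basis m) : bool :=
  [forall q : 'I_m, (q \notin qs) ==> (b q == b' q)].

(* A on the qubits qs (in this order) tensored with the identity elsewhere. *)
Definition local_op (A : 'M[C]_(hdim k)) : 'M[C]_(hdim m) :=
  \matrix_(i, j)
    if agree_off (enum_val i) (enum_val j)
    then A (enum_rank (local_state (enum_val i)))
           (enum_rank (local_state (enum_val j)))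
    else 0.

(* Partial trace over all the qubits that are not in qs. *)
Definition partial_trace (A : 'M[C]_(hdim m)) : 'M[C]_(hdim k) :=
  \matrix_(i, j)
    \sum_(b : basis m | local_state b == enum_val i)
      \sum_(b' : basis m | (local_state b' == enum_val j) && agree_off b b')
        A (enum_rank b) (enum_rank b').

Definition merge_state (b : basis m) (t : basis k) : basis m :=
  [ffun q => if [pick l | tnth qs l == q] is Some l then t l else b q].

Hypothesis uqs : uniq qs.

Lemma agree_off_refl b : agree_off b b.
Proof. by apply/forallP => q; apply/implyP. Qed.

Lemma agree_offC b b' : agree_off b b' = agree_off b' b.
Proof. by apply: eq_forallb => q; rewrite eq_sym. Qed.

Lemma agree_off_trans b b' s :
  agree_off b s -> agree_off s b' = agree_off b b'.
Proof.
move/forallP => H; apply: eq_forallb => q.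
by case: (boolP (q \in qs)) (H q) => //= _ /eqP ->.
Qed.

Lemma local_mergeK b t : local_state (merge_state b t) = t.
Proof.
apply/ffunP => l; rewrite !ffunE; case: pickP => [l' /eqP|/(_ l)]; last by rewrite eqxx.
by move/(tuple_uniqP _ uqs) => ->.
Qed.

Lemma merge_localK b s : agree_off b s -> merge_state b (local_state s) = s.
Proof.
move/forallP => H; apply/ffunP => q; rewrite !ffunE.
case: pickP => [l /eqP <-|N]; first by rewrite ffunE.
apply/eqP; apply: (implyP (H q)); apply/negP => /tnthP [l E].
by have := N l; rewrite -E eqxx.
Qed.

Lemma agree_merge b t : agree_off b (merge_state b t).
Proof.
apply/forallP => q; apply/implyP => nq; rewrite ffunE.
by case: pickP => // l /eqP E; rewrite -E mem_tnth in nq.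
Qed.

Lemma local_opM A B : local_op (A *m B) = local_op A *m local_op B.
Proof.
apply/matrixP => i j; rewrite !mxE.
set b := enum_val i; set b' := enum_val j.
rewrite (reindex (@enum_rank (basis m))) /=; last first.
  by exists enum_val => x _; rewrite ?enum_rankK ?enum_valK.
rewrite (eq_bigr (fun s => if agree_off b s then
   if agree_off b b' then A (enum_rank (local_state b)) (enum_rank (local_state s))
     * B (enum_rank (local_state s)) (enum_rank (local_state b')) else 0 else 0)); last first.
  move=> s _; rewrite !mxE !enum_rankK -/b -/b'.
  case: ifP => H; last by rewrite mul0r.
  by rewrite (agree_off_trans _ H); case: ifP => _; rewrite ?mulr0.
rewrite -big_mkcond /=.
rewrite (reindex_onto (merge_state b) local_state) /=; last exact: merge_localK.
rewrite [RHS](eq_bigl xpredT) => [|t]; last by rewrite agree_merge local_mergeK eqxx.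
case: ifP => H; last by rewrite big1.
rewrite (reindex (@enum_rank (basis k))) /=; last first.
  by exists enum_val => x _; rewrite ?enum_rankK ?enum_valK.
by apply: eq_bigr => t _; rewrite local_mergeK.
Qed.

Lemma local_op1 : local_op 1%:M = 1%:M.
Proof.
apply/matrixP => i j; rewrite !mxE.
rewrite (inj_eq enum_rank_inj) -[in RHS](inj_eq enum_val_inj).
case: ifP => [H|/negP H].
  congr (_%:R); congr nat_of_bool.
  apply/eqP/eqP => [E|->//].
  by rewrite -(merge_localK H) -E (merge_localK (agree_off_refl _)).
by case: eqP => // E; case: H; rewrite E agree_off_refl.
Qed.

Lemma local_opD A B : local_op (A + B) = local_op A + local_op B.
Proof. by apply/matrixP => i j; rewrite !mxE; case: ifP; rewrite ?addr0. Qed.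

Lemma local_op_adj A : local_op (A ^t*) = (local_op A) ^t*.
Proof.
apply/matrixP => i j; rewrite !mxE agree_offC.
by case: ifP; rewrite ?conjC0 // !mxE.
Qed.

Lemma local_op_unitary A : A \is unitarymx -> local_op A \is unitarymx.
Proof.
by move/unitarymxP => H; apply/unitarymxP; rewrite -local_op_adj -local_opM H local_op1.
Qed.

End LocalOperators.

(* The projector |i><i| on one qubit. *)
Definition ketbra (C : numClosedFieldType) (i : 'I_2) : 'M[C]_(hdim 1) :=
  let e := enum_rank [ffun=> i] in delta_mx e e.

Section QuantumStates.
Variables (R : realType) (m : nat).
Local Notation C := R[i].
Local Notation ket := 'cV[C]_(hdim m).

Definition is_unit_ket (v : ket) : bool := v ^t* *m v == 1%:M.

Definition unit_ket := {v : ket | is_unit_ket v}.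

Definition same_ray (u v : unit_ket) : bool :=
  `[< exists2 c : C, `|c| = 1 & val u = c *: val v >].

Lemma same_ray_refl : reflexive same_ray.
Proof. by move=> u; apply/asboolP; exists 1; rewrite ?normr1 ?scale1r. Qed.

Lemma same_ray_sym : symmetric same_ray.
Proof.
suff H u v : same_ray u v -> same_ray v u by move=> u v; apply/idP/idP; apply: H.
move/asboolP => [c c1 E]; apply/asboolP; exists c^-1; first by rewrite normfV c1 invr1.
by rewrite E scalerA mulVf ?scale1r // -normr_eq0 c1 oner_eq0.
Qed.

Lemma same_ray_trans : transitive same_ray.
Proof.
move=> v u w /asboolP [c c1 E] /asboolP [d d1 F]; apply/asboolP.
by exists (c * d); rewrite ?E ?F ?scalerA // normrM c1 d1 mulr1.
Qed.

Canonical same_ray_equiv :=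
  EquivRel same_ray same_ray_refl same_ray_sym same_ray_trans.

Definition qstate := {eq_quot same_ray_equiv}.
HB.instance Definition _ := Choice.on qstate.
HB.instance Definition _ := EqQuotient.on qstate.


Lemma rayP (u v : unit_ket) :
  reflect (exists2 c : C, `|c| = 1 & val u = c *: val v)
          (\pi_qstate u == \pi_qstate v).
Proof. by rewrite eqmodE; apply: asboolP. Qed.

(* A unitary together with the list of distinct qubits on which it acts. *)
Record gate := Gate {
  gate_arity : nat;
  gate_qubits : gate_arity.-tuple 'I_m;
  gate_qubits_uniq : uniq gate_qubits;
  gate_mx : 'M[C]_(hdim gate_arity);
  gate_unitary : gate_mx \is unitarymx }.

Lemma unit_ket_unitary (L : 'M[C]_(hdim m)) (v : ket) :
  L \is unitarymx -> is_unit_ket v -> is_unit_ket (L *m v).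
Proof.
rewrite -trmxC_unitary => /unitarymxP; rewrite trmxCK => H /eqP v1; apply/eqP.
by rewrite trmx_mul map_mxM -mulmxA (mulmxA _ L) H mul1mx.
Qed.

Definition gate_ket (g : gate) (u : unit_ket) : unit_ket :=
  Sub (local_op (gate_qubits g) (gate_mx g) *m val u)
      (unit_ket_unitary
         (local_op_unitary (gate_qubits_uniq g) (gate_unitary g)) (valP u)).

Definition density (u : unit_ket) : 'M[C]_(hdim m) := val u *m (val u) ^t*.

Definition meas_op (i : 'I_2) (q : 'I_m) : 'M[C]_(hdim m) :=
  local_op [tuple q] (ketbra C i).

(* The trace is a nonnegative real number of C (trace_meas_op); Re casts it to R. *)
Definition meas_prob_ket (i : 'I_2) (q : 'I_m) (u : unit_ket) : R :=
  complex.Re (\tr (meas_op i q *m density u)).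

Definition post_meas_vec (i : 'I_2) (q : 'I_m) (u : unit_ket) : ket :=
  ((Num.sqrt (meas_prob_ket i q u))%:C)^-1 *: (meas_op i q *m val u).

(* For meas_prob_ket i q u = 0 the value is the irrelevant default u; otherwise
   post_meas_vec i q u is a unit vector (post_meas_vec_unit). *)
Definition post_meas_ket (i : 'I_2) (q : 'I_m) (u : unit_ket) : unit_ket :=
  insubd u (post_meas_vec i q u).

Definition gate_apply (g : gate) (s : qstate) : qstate :=
  \pi_qstate (gate_ket g (repr s)).

Definition meas_prob (i : 'I_2) (q : 'I_m) (s : qstate) : R :=
  meas_prob_ket i q (repr s).

Definition post_meas (i : 'I_2) (q : 'I_m) (s : qstate) : qstate :=
  \pi_qstate (post_meas_ket i q (repr s)).

Definition reduced_density (q : 'I_m) (s : qstate) : 'M[C]_(hdim 1) :=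
  partial_trace [tuple q] (density (repr s)).

Lemma uniq_tuple1 (q : 'I_m) : uniq [tuple q]. Proof. by []. Qed.

Lemma meas_op_adj i q : (meas_op i q) ^t* = meas_op i q.
Proof.
rewrite /meas_op -local_op_adj; congr local_op.
by apply/matrixP => a b; rewrite !mxE rmorph_nat andbC.
Qed.

Lemma meas_op_idem i q : meas_op i q *m meas_op i q = meas_op i q.
Proof. by rewrite /meas_op -local_opM ?uniq_tuple1 // mul_delta_mx. Qed.

Lemma meas_op_sum q : meas_op ord0 q + meas_op ord_max q = 1%:M.
Proof.
rewrite /meas_op -local_opD -(local_op1 _ [tuple q]); congr local_op.
apply/matrixP => a b; rewrite !mxE.
rewrite -[a]enum_valK -[b]enum_valK !(inj_eq enum_rank_inj).
move: (enum_val a) (enum_val b) => {a b} a b.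
have E (c d : basis 1) : (c == d) = (c ord0 == d ord0).
  apply/eqP/eqP => [->//|H]; apply/ffunP => x.
  by rewrite (ord1 x).
rewrite !E !ffunE.
by case: (a _) (b _) => [[|[|//]] ?] [[|[|//]] ?] /=; rewrite -natrD.
Qed.

Lemma trace_meas_op i q u :
  \tr (meas_op i q *m density u)
    = \sum_a `|(meas_op i q *m val u) a 0| ^+ 2.
Proof.
have -> : meas_op i q *m density u
    = (meas_op i q) ^t* *m (meas_op i q *m val u) *m (val u) ^t*.
  by rewrite meas_op_adj /density !mulmxA meas_op_idem.
rewrite mxtrace_mulC mulmxA.
have -> : (val u) ^t* *m (meas_op i q) ^t* = (meas_op i q *m val u) ^t*.
  by rewrite trmx_mul map_mxM.
rewrite trace_mx11 mxE; apply: eq_bigr => a _.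
by rewrite !mxE mulrC normCK.
Qed.

Lemma meas_prob_ket_ge0 i q u : 0 <= meas_prob_ket i q u.
Proof.
have : 0 <= \tr (meas_op i q *m density u).
  by rewrite trace_meas_op sumr_ge0 // => a _; rewrite exprn_ge0.
by rewrite lecE => /andP [].
Qed.

Lemma meas_prob_ketE i q u :
  (meas_prob_ket i q u)%:C = \tr (meas_op i q *m density u).
Proof.
have : 0 <= \tr (meas_op i q *m density u).
  by rewrite trace_meas_op sumr_ge0 // => a _; rewrite exprn_ge0.
by rewrite /meas_prob_ket; case: (\tr _) => x y; rewrite lecE /= => /andP [/eqP -> _].
Qed.

Lemma meas_prob_ket_sum q u :
  meas_prob_ket ord0 q u + meas_prob_ket ord_max q u = 1.
Proof.
apply: (fmorph_inj (real_complex R)); rewrite rmorphD /= !meas_prob_ketE.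
rewrite -mxtraceD -mulmxDl meas_op_sum mul1mx /density mxtrace_mulC.
by rewrite (eqP (valP u)) mxtrace1.
Qed.

Lemma post_meas_vec_unit i q u :
  0 < meas_prob_ket i q u -> is_unit_ket (post_meas_vec i q u).
Proof.
move=> p0; apply/eqP/matrixP => a b; rewrite !ord1 !mxE eqxx.
set p := meas_prob_ket i q u in p0 *.
have s0 : 0 < Num.sqrt p by rewrite sqrtr_gt0.
transitivity ((p%:C)^-1 * \tr (meas_op i q *m density u)).
  rewrite trace_meas_op mulr_sumr; apply: eq_bigr => c _.
  rewrite !mxE rmorphM /= fmorphV /=.
  rewrite normCK mulrACA [X in _ = _ * X]mulrC; congr (_ * _).
  have -> : p%:C = (Num.sqrt p)%:C * (Num.sqrt p)%:C.
    by rewrite -rmorphM -expr2 sqr_sqrtr // ltW.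
  rewrite invfM; congr (_^-1 * _).
  exact: conjc_real.
rewrite -meas_prob_ketE mulVf //.
by rewrite -(rmorph0 (real_complex R)) (inj_eq (fmorph_inj _)) gt_eqF.
Qed.

(* The operations on rays do not depend on the representatives. *)
Lemma density_ray u v : \pi_qstate u = \pi_qstate v -> density u = density v.
Proof.
move/eqP/rayP => [c c1 E]; rewrite /density E.
rewrite linearZ /= map_mxZ -scalemxAl -scalemxAr scalerA -normCK c1.
by rewrite expr1n scale1r.
Qed.

Lemma gate_apply_pi g u : gate_apply g (\pi u) = \pi_qstate (gate_ket g u).
Proof.
have /esym/eqP/rayP [c c1 E] : \pi_qstate u = \pi_qstate (repr (\pi_qstate u)).
  by rewrite reprK.
apply/eqP/rayP; exists c => //.
by rewrite /= E -scalemxAr.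
Qed.

Lemma meas_prob_pi i q u : meas_prob i q (\pi u) = meas_prob_ket i q u.
Proof. by rewrite /meas_prob /meas_prob_ket (@density_ray _ u) ?reprK. Qed.

Lemma post_meas_pi i q u :
  0 < meas_prob_ket i q u ->
  post_meas i q (\pi u) = \pi_qstate (post_meas_ket i q u).
Proof.
move=> p0; set w := repr (\pi_qstate u).
have pw : meas_prob_ket i q w = meas_prob_ket i q u by exact: meas_prob_pi.
have /eqP/rayP [c c1 E] : \pi_qstate w = \pi_qstate u by rewrite reprK.
apply/eqP/rayP; exists c => //.
rewrite /post_meas_ket !val_insubd !post_meas_vec_unit ?pw //.
by rewrite /post_meas_vec pw E -scalemxAr !scalerA mulrC.
Qed.

Lemma reduced_density_pi q u :
  reduced_density q (\pi u) = partial_trace [tuple q] (density u).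
Proof. by rewrite /reduced_density (@density_ray _ u) ?reprK. Qed.

End QuantumStates.

Section Syntax.
Variables (R : realType) (m : nat) (PV LV : eqType).

Inductive aexp : Type :=
| ANum of int
| AVar of PV
| AOp of (int -> int -> int) & aexp & aexp.

Inductive bexp : Type :=
| BTrue
| BFalse
| BRel of (int -> int -> bool) & aexp & aexp
| BNot of bexp
| BAnd of bexp & bexp.

(* A list a_1 : k_1, ..., a_n : k_n with 0 < a_i < 1 and a_1 + ... + a_n = 1
   (hence n >= 2). *)
Record lottery := Lottery {
  lottery_seq :> seq (R * int);
  lottery_weights : all (fun ak => 0 < ak.1 < 1) lottery_seq;
  lottery_sum1 : \sum_(ak <- lottery_seq) ak.1 = 1 }.

Inductive cmd : Type :=
| Skip
| Assign of PV & aexp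
| Sample of PV & lottery
| Seq of cmd & cmd
| If of bexp & cmd & cmd
| While of bexp & cmd
| Apply of gate R m
| Measure of PV & 'I_m.

Inductive lexp : Type :=
| LNum of int
| LPVar of PV
| LLVar of LV
| LOp of (int -> int -> int) & lexp & lexp.

(* FProj i j is P^i_j, FGate g f is [U_q]f and FMeas i j f is [P^i_j]f, the
   modality for the outcome i of the measurement of qubit j. *)
Inductive assn : Type :=
| FTrue
| FFalse
| FProj of 'I_2 & 'I_m
| FRel of (int -> int -> bool) & lexp & lexp
| FNot of assn
| FAnd of assn & assn
| FForall of LV & assn
| FGate of gate R m & assn
| FMeas of 'I_2 & 'I_m & assn
| FBigAnd of (nat -> assn).

Definition FOr (f g : assn) : assn := FNot (FAnd (FNot f) (FNot g)).

(* f_1 /\ ... /\ f_n; the value on the empty list plays no role. *)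
Definition FAndSeq (s : seq assn) : assn :=
  if s is f :: s' then foldl FAnd f s' else FTrue.

Fixpoint lexp_of_aexp (E : aexp) : lexp :=
  match E with
  | ANum n => LNum n
  | AVar X => LPVar X
  | AOp op E1 E2 => LOp op (lexp_of_aexp E1) (lexp_of_aexp E2)
  end.

Fixpoint assn_of_bexp (B : bexp) : assn :=
  match B with
  | BTrue => FTrue
  | BFalse => FFalse
  | BRel r E1 E2 => FRel r (lexp_of_aexp E1) (lexp_of_aexp E2)
  | BNot B1 => FNot (assn_of_bexp B1)
  | BAnd B1 B2 => FAnd (assn_of_bexp B1) (assn_of_bexp B2)
  end.

Fixpoint lexp_subst (X : PV) (E : aexp) (e : lexp) : lexp :=
  match e with
  | LNum n => LNum n
  | LPVar Y => if Y == X then lexp_of_aexp E else LPVar Y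
  | LLVar x => LLVar x
  | LOp op e1 e2 => LOp op (lexp_subst X E e1) (lexp_subst X E e2)
  end.

(* No capture can occur: E contains no logical variable. *)
Fixpoint assn_subst (X : PV) (E : aexp) (f : assn) : assn :=
  match f with
  | FTrue => FTrue
  | FFalse => FFalse
  | FProj i j => FProj i j
  | FRel r e1 e2 => FRel r (lexp_subst X E e1) (lexp_subst X E e2)
  | FNot f1 => FNot (assn_subst X E f1)
  | FAnd f1 f2 => FAnd (assn_subst X E f1) (assn_subst X E f2)
  | FForall x f1 => FForall x (assn_subst X E f1)
  | FGate g f1 => FGate g (assn_subst X E f1)
  | FMeas i j f1 => FMeas i j (assn_subst X E f1)
  | FBigAnd fs => FBigAnd (fun n => assn_subst X E (fs n))
  end.

End Syntax.

Arguments FTrue {R m PV LV}.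
Arguments FFalse {R m PV LV}.
Arguments FProj {R m PV LV}.
Arguments Skip {R m PV}.
Arguments ANum {PV}.
Arguments LNum {PV LV}.

Local Open Scope ereal_scope.
Local Open Scope classical_set_scope.

Definition update (T : eqType) (f : T -> int) (x : T) (n : int) : T -> int :=
  fun y => if y == x then n else f y.

Section Semantics.
Variables (R : realType) (m : nat) (PV LV : eqType).

Definition cstate := PV -> int.

Definition cqstate : Type := cstate * qstate R m.
HB.instance Definition _ := Choice.on cqstate.

Fixpoint aeval (E : aexp PV) (S : cstate) : int :=
  match E with
  | ANum n => n
  | AVar X => S X
  | AOp op E1 E2 => op (aeval E1 S) (aeval E2 S)
  end.

Fixpoint beval (B : bexp PV) (S : cstate) : bool :=
  match B with
  | BTrue => true
  | BFalse => false
  | BRel r E1 E2 => r (aeval E1 S) (aeval E2 S)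
  | BNot B1 => ~~ beval B1 S
  | BAnd B1 B2 => beval B1 S && beval B2 S
  end.

Definition cq_set (X : PV) (n : int) (t : cqstate) : cqstate :=
  (update t.1 X n, t.2).

Definition cq_gate (g : gate R m) (t : cqstate) : cqstate :=
  (t.1, gate_apply g t.2).

Definition cq_post (i : 'I_2) (j : 'I_m) (t : cqstate) : cqstate :=
  (t.1, post_meas i j t.2).

(* Commands are first interpreted on arbitrary functions to [-oo, +oo], where all
   the sums make sense; denote_pcq shows that probabilistic cq-states are mapped
   to probabilistic cq-states. *)
Definition point_dist (t : cqstate) : cqstate -> \bar R := fun t' => (t' == t)%:R%:E.

Definition restrict (B : bexp PV) (D : cqstate -> \bar R) : cqstate -> \bar R :=
  fun t => if beval B t.1 then D t else 0.

Definition extend (K : cqstate -> cqstate -> \bar R) (D : cqstate -> \bar R) :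
    cqstate -> \bar R :=
  fun t' => \esum_(t in [set: cqstate]) (D t * K t t').

Fixpoint denote (c : cmd R m PV) (D : cqstate -> \bar R) : cqstate -> \bar R :=
  match c with
  | Skip => D
  | Assign X E => extend (fun t => point_dist (cq_set X (aeval E t.1) t)) D
  | Sample X l =>
      fun t' => \sum_(ak <- lottery_seq l)
                  (ak.1%:E * extend (fun t => point_dist (cq_set X ak.2 t)) D t')
  | Seq c1 c2 => denote c2 (denote c1 D)
  | If B c1 c2 =>
      fun t => denote c1 (restrict B D) t + denote c2 (restrict (BNot B) D) t
  | While B c1 =>
      fun t => \sum_(0 <= i <oo)
        restrict (BNot B) (iter i (fun D' => denote c1 (restrict B D')) D) t
  | Apply g => extend (fun t => point_dist (cq_gate g t)) D
  | Measure X j =>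
      extend (fun t t' => \sum_(i < 2)
        ((meas_prob i j t.2)%:E * point_dist (cq_set X (nat_of_ord i)%:Z (cq_post i j t)) t')) D
  end.

Definition mass (D : cqstate -> \bar R) : \bar R :=
  \esum_(t in [set: cqstate]) D t.

Record pcq := Pcq {
  pcq_fun :> cqstate -> \bar R;
  pcq_ge0 : forall t, 0 <= pcq_fun t;
  pcq_mass : mass pcq_fun <= 1 }.

Implicit Types (D : cqstate -> \bar R) (K : cqstate -> cqstate -> \bar R).

Lemma esumZ_le (T : choiceType) (x : \bar R) (f : T -> \bar R) :
  0 <= x -> (forall t, 0 <= f t) ->
  \esum_(t in [set: T]) (x * f t) <= x * \esum_(t in [set: T]) f t.
Proof.
move=> x0 f0; apply: ge_ereal_sup => _ [A [finA _] <-].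
rewrite -ge0_mule_fsumr; last exact: f0.
apply: lee_wpmul2l => //; apply: ereal_sup_ubound; by exists A.
Qed.

Lemma esum_exchange (T1 T2 : choiceType) (f : T1 -> T2 -> \bar R) :
  (forall a b, 0 <= f a b) ->
  \esum_(a in [set: T1]) \esum_(b in [set: T2]) f a b =
  \esum_(b in [set: T2]) \esum_(a in [set: T1]) f a b.
Proof.
move=> f0; rewrite (@esum_esum R T1 T2 setT (fun=> setT) f) ?(@esum_esum R T2 T1 setT (fun=> setT) (fun b a => f a b)) //.
rewrite (@reindex_esum R _ _ ([set: T2] `*`` (fun=> setT)) _ (fun p => (p.2, p.1))) //.
split => //=.
- by move=> [a b] [b' a'] _ _ [-> ->].
- by move=> [a b] _; exists (b, a).
Qed.

Lemma mass_point_dist t : mass (point_dist t) = 1.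
Proof.
rewrite /mass -[RHS](@esum_set1 R _ t (fun=> 1)) // esum_mkcond [RHS]esum_mkcond.
apply: eq_esum => t' _; rewrite /point_dist in_setT.
case: eqVneq => [->|/eqP n]; first by rewrite mem_set.
by rewrite memNset.
Qed.

Lemma point_dist_ge0 t t' : 0 <= point_dist t t'.
Proof. by rewrite lee_fin ler0n. Qed.

Lemma restrict_ge0 B D : (forall t, 0 <= D t) -> forall t, 0 <= restrict B D t.
Proof. by move=> D0 t; rewrite /restrict; case: ifP. Qed.

Lemma mass_restrict B D : (forall t, 0 <= D t) ->
  mass (restrict B D) + mass (restrict (BNot B) D) = mass D.
Proof.
move=> D0; rewrite /mass -esumD => [||]; try by move=> *; exact: restrict_ge0.
by apply: eq_esum => t _; rewrite /restrict /=; case: ifP; rewrite ?adde0 ?add0e.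
Qed.

Lemma extend_ge0 K D : (forall t t', 0 <= K t t') -> (forall t, 0 <= D t) ->
  forall t, 0 <= extend K D t.
Proof. by move=> K0 D0 t; apply: esum_ge0 => t' _; rewrite mule_ge0. Qed.

Lemma mass_extend K D : (forall t t', 0 <= K t t') -> (forall t, 0 <= D t) ->
  (forall t, mass (K t) <= 1) -> mass (extend K D) <= mass D.
Proof.
move=> K0 D0 K1; rewrite /mass /extend esum_exchange => [|a b]; last by rewrite mule_ge0.
apply: le_esum => t _; apply: (le_trans (esumZ_le (D0 t) (K0 t))).
by rewrite -[leRHS]mule1; apply: lee_wpmul2l => //; exact: K1.
Qed.

Lemma mass_bigsum (I : choiceType) (s : seq I) (F : I -> cqstate -> \bar R) :
  (forall i t, 0 <= F i t) ->
  mass (fun t => \sum_(i <- s) F i t) = \sum_(i <- s) mass (F i).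
Proof.
move=> F0; apply: (@esum_sum R _ I setT s xpredT (fun t i => F i t)) => t i _ _.
exact: F0.
Qed.

Lemma mass_series (F : nat -> cqstate -> \bar R) :
  (forall i t, 0 <= F i t) ->
  mass (fun t => \sum_(0 <= i <oo) F i t) = \sum_(0 <= i <oo) mass (F i).
Proof.
move=> F0; rewrite nneseries_esumT => [|i]; last exact: esum_ge0.
rewrite /mass esum_exchange //.
by apply: eq_esum => t _; rewrite nneseries_esumT.
Qed.

Lemma denote_ge0 c D : (forall t, 0 <= D t) -> forall t, 0 <= denote c D t.
Proof.
elim: c D => [|X E|X l|c1 IH1 c2 IH2|B c1 IH1 c2 IH2|B c IH|g|X j] D D0 //=.
- exact/extend_ge0/D0/(fun _ => point_dist_ge0 _).
- move=> t; rewrite big_seq; apply: sume_ge0 => ak akl.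
  have /andP [a0 _] := allP (lottery_weights l) _ akl.
  apply: mule_ge0; first by rewrite lee_fin ltW.
  by apply: extend_ge0 => // *; exact: point_dist_ge0.
- by apply: IH2; apply: IH1.
- by move=> t; rewrite adde_ge0 // ?IH1 ?IH2 // => t'; exact: restrict_ge0.
- move=> t; apply: nneseries_ge0 => i _ _; apply: restrict_ge0 => {}t.
  by elim: i t => //= i IHi t; apply: IH => t'; exact: restrict_ge0.
- exact/extend_ge0/D0/(fun _ => point_dist_ge0 _).
- apply: extend_ge0 => // t t'; apply: sume_ge0 => i _.
  by rewrite mule_ge0 ?point_dist_ge0 // lee_fin meas_prob_ket_ge0.
Qed.

Lemma mass_denote c D : (forall t, 0 <= D t) -> mass (denote c D) <= mass D.
Proof.
elim: c D => [|X E|X l|c1 IH1 c2 IH2|B c1 IH1 c2 IH2|B c IH|g|X j] D D0 //=.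
- by apply: mass_extend => // *; rewrite ?point_dist_ge0 ?mass_point_dist.
- have E0 ak t : 0 <= extend (fun t => point_dist (cq_set X ak t)) D t.
    by apply: extend_ge0 => // *; exact: point_dist_ge0.
  rewrite (_ : mass _ = mass (fun t' => \sum_(ak <- lottery_seq l)
    (`|ak.1|%:E * extend (fun t => point_dist (cq_set X ak.2 t)) D t'))); last first.
    apply: eq_esum => t _; rewrite !big_seq; apply: eq_bigr => ak akl.
    have /andP [a0 _] := allP (lottery_weights l) _ akl.
    by rewrite gtr0_norm.
  rewrite mass_bigsum => [|i t]; last by rewrite mule_ge0 ?lee_fin.
  apply: (@le_trans _ _ (\sum_(ak <- lottery_seq l) (ak.1%:E * mass D))).
    rewrite !big_seq; apply: lee_sum => ak akl.
    have /andP [a0 _] := allP (lottery_weights l) _ akl.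
    rewrite gtr0_norm //; apply: le_trans (esumZ_le _ (E0 _)) _; first by rewrite lee_fin ltW.
    apply: lee_wpmul2l; first by rewrite lee_fin ltW.
    by apply: mass_extend => // *; rewrite ?point_dist_ge0 ?mass_point_dist.
  rewrite big_seq -ge0_sume_distrl; last first.
    move=> ak akl; have /andP [a0 _] := allP (lottery_weights l) _ akl.
    by rewrite lee_fin ltW.
  by rewrite -big_seq sumEFin lottery_sum1 mul1e.
- exact: le_trans (IH2 _ (denote_ge0 c1 D0)) (IH1 _ D0).
- rewrite -(mass_restrict B D0) /mass esumD; try by move=> *; apply: denote_ge0; exact: restrict_ge0.
  by apply: leeD; [apply: IH1|apply: IH2]; exact: restrict_ge0.
- set F := fun D' => denote c (restrict B D').
  have F0 i t : 0 <= iter i F D t.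
    by elim: i t => //= i IHi t; apply: denote_ge0; exact: restrict_ge0.
  rewrite mass_series => [|i]; last exact: restrict_ge0.
  apply: lime_le; first by apply: is_cvg_nneseries => i _ _; apply: esum_ge0 => *; exact: restrict_ge0.
  apply: nearW => n.
  suff : \sum_(0 <= i < n) mass (restrict (BNot B) (iter i F D)) + mass (iter n F D) <= mass D.
    by apply: le_trans; rewrite leeDl // esum_ge0.
  elim: n => [|n IHn]; first by rewrite big_geq // add0e.
  apply: le_trans IHn; rewrite big_nat_recr //= -addeA; apply: leeD2l.
  rewrite -(mass_restrict B (F0 n)) addeC; apply: leeD2r.
  by apply: IH; exact: restrict_ge0.
- by apply: mass_extend => // *; rewrite ?point_dist_ge0 ?mass_point_dist.
- have H0 t t' (i : 'I_2) : 0 <= (meas_prob i j t.2)%:E *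
      point_dist (cq_set X (nat_of_ord i)%:Z (cq_post i j t)) t'.
    by rewrite mule_ge0 ?point_dist_ge0 // lee_fin meas_prob_ket_ge0.
  apply: mass_extend => // t; first by move=> t'; apply: sume_ge0.
  rewrite mass_bigsum //.
  apply: (@le_trans _ _ (\sum_(i < 2) (meas_prob i j t.2)%:E)).
    apply: lee_sum => i _; apply: le_trans (esumZ_le _ (point_dist_ge0 _)) _.
      by rewrite lee_fin meas_prob_ket_ge0.
    by rewrite -/(mass _) mass_point_dist mule1.
  rewrite sumEFin lee_fin big_ord_recl big_ord1 -(meas_prob_ket_sum j (repr t.2)).
  by rewrite (_ : lift ord0 ord0 = ord_max) //; exact: val_inj.
Qed.

Lemma denote_pcq_mass c (D : pcq) : mass (denote c D) <= 1.
Proof. exact: le_trans (mass_denote c (pcq_ge0 D)) (pcq_mass D). Qed.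

Definition denote_pcq (c : cmd R m PV) (D : pcq) : pcq :=
  Pcq (denote_ge0 c (pcq_ge0 D)) (denote_pcq_mass c D).

Lemma mass_point_dist_le1 t : mass (point_dist t) <= 1.
Proof. by rewrite mass_point_dist. Qed.

Definition point_pcq (t : cqstate) : pcq := Pcq (point_dist_ge0 t) (mass_point_dist_le1 t).

Definition interp := LV -> int.

Fixpoint leval (e : lexp PV LV) (I : interp) (t : cqstate) : int :=
  match e with
  | LNum n => n
  | LPVar X => t.1 X
  | LLVar x => I x
  | LOp op e1 e2 => op (leval e1 I t) (leval e2 I t)
  end.

Fixpoint sat (f : assn R m PV LV) (I : interp) (t : cqstate) : Prop :=
  match f with
  | FTrue => True
  | FFalse => False
  | FProj i j => (\tr (ketbra _ i *m reduced_density j t.2) = 1)%R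
  | FRel r e1 e2 => r (leval e1 I t) (leval e2 I t)
  | FNot f1 => ~ sat f1 I t
  | FAnd f1 f2 => sat f1 I t /\ sat f2 I t
  | FForall x f1 => forall n : int, sat f1 (update I x n) t
  | FGate g f1 => sat f1 I (cq_gate g t)
  | FMeas i j f1 => (0 < meas_prob i j t.2)%R /\ sat f1 I (cq_post i j t)
  | FBigAnd fs => forall n, sat (fs n) I t
  end.

Definition psat (f : assn R m PV LV) (I : interp) (D : pcq) : Prop :=
  forall t, 0 < D t -> sat f I t.

Definition entails (f g : assn R m PV LV) : Prop :=
  forall I t, sat f I t -> sat g I t.

Definition valid (f : assn R m PV LV) (c : cmd R m PV) (g : assn R m PV LV) :
    Prop :=
  forall I t, sat f I t -> psat g I (denote_pcq c (point_pcq t)).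

End Semantics.

Section ProofSystem.
Variables (R : realType) (m : nat) (PV LV : eqType).

Inductive derivable :
    assn R m PV LV -> cmd R m PV -> assn R m PV LV -> Prop :=
| D_Skip f : derivable f Skip f
| D_Assign f X E : derivable (assn_subst X E f) (Assign R m X E) f
| D_Sample f X (l : lottery R) :
    derivable (FAndSeq [seq assn_subst X (ANum ak.2) f | ak <- lottery_seq l])
              (Sample m X l) f
| D_Seq f f1 f2 c1 c2 :
    derivable f c1 f1 -> derivable f1 c2 f2 -> derivable f (Seq c1 c2) f2
| D_If f g B c1 c2 :
    derivable (FAnd f (assn_of_bexp R m LV B)) c1 g ->
    derivable (FAnd f (FNot (assn_of_bexp R m LV B))) c2 g ->
    derivable f (If B c1 c2) g
| D_While f B c :
    derivable (FAnd f (assn_of_bexp R m LV B)) c f ->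
    derivable f (While B c) (FAnd f (FNot (assn_of_bexp R m LV B)))
| D_Gate f g : derivable (FGate g f) (Apply PV g) f
| D_Measure f X j :
    derivable
      (FAnd (FOr (FMeas ord0 j (assn_subst X (ANum 0) f)) (FProj ord_max j))
            (FOr (FMeas ord_max j (assn_subst X (ANum 1) f)) (FProj ord0 j)))
      (Measure R X j) f
| D_Cons f' f c g g' :
    entails f' f -> derivable f c g -> entails g g' -> derivable f' c g'.

End ProofSystem.

(* Main.v *)
(** Soundness is proved by induction on the derivation for the stronger
    notion of validity in which the point distribution is replaced
    by an arbitrary nonnegative function on cq-states: every command transports
    supports, since a sum of nonnegative terms is positive only if one of its
    terms is.  The only quantum fact needed is that [local_op] is adjoint to the
    partial trace, so that [P^i_j] holds exactly when outcome [i] on qubit [j]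
    has probability one, which excludes the other outcome. *)
From mathcomp Require Import complex boolp classical_sets ereal sequences esum.
Require Import Defs.
From HB Require Import structures.
From mathcomp Require Import all_boot all_order all_algebra.
From mathcomp Require Import reals.

Import Order.TTheory GRing.Theory Num.Theory.

Section PartialTrace.
Local Open Scope ring_scope.

(** Both sides expand to the sum of [A s' s * B b b'] over the pairs [b], [b'] of basis states that
    agree off [qs], where [s] and [s'] are their restrictions to [qs]. *)
Lemma mxtrace_partial_trace (C : numClosedFieldType) (m k : nat)
    (qs : k.-tuple 'I_m) (A : 'M[C]_(hdim k)) (B : 'M[C]_(hdim m)) :
  \tr (A *m partial_trace qs B) = \tr (local_op qs A *m B).
Proof.
have reindex_basis n (F : 'I_(hdim n) -> C) :
    \sum_i F i = \sum_(b : {ffun 'I_n -> 'I_2}) F (enum_rank b).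
  apply: (reindex (@enum_rank {ffun 'I_n -> 'I_2})).
  by exists enum_val => x _; rewrite ?enum_rankK ?enum_valK.
rewrite /mxtrace !reindex_basis.
transitivity (\sum_(b' : {ffun 'I_m -> 'I_2}) \sum_(b : {ffun 'I_m -> 'I_2})
  (if agree_off qs b b'
   then A (enum_rank (local_state qs b')) (enum_rank (local_state qs b)) *
     B (enum_rank b) (enum_rank b') else 0)); last first.
  apply: eq_bigr => b' _; rewrite mxE reindex_basis; apply: eq_bigr => b _.
  rewrite mxE !enum_rankK agree_offC; case: ifP => // _; by rewrite mul0r.
(* Grouping by the restrictions to [qs], first of [b'] and then of [b], brings out the two indices
   of the matrix product on the left. *)
rewrite [RHS](partition_big (local_state qs) xpredT) //=.
apply: eq_bigr => s' _; rewrite mxE reindex_basis [RHS]exchange_big /=.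
rewrite [RHS](partition_big (local_state qs) xpredT) //=.
apply: eq_bigr => s _; rewrite mxE !enum_rankK mulr_sumr.
apply: eq_bigr => b /eqP <-; rewrite mulr_sumr.
rewrite -[RHS]big_mkcondr /=; apply: eq_bigr => b' /andP [/eqP <- _] //.
Qed.

Lemma meas_prob_sum (R : realType) (m : nat) (q : 'I_m) (s : qstate R m) :
  meas_prob ord0 q s + meas_prob ord_max q s = 1.
Proof. exact: meas_prob_ket_sum. Qed.

Lemma mxtrace_reduced_density (R : realType) (m : nat) (i : 'I_2) (q : 'I_m)
    (s : qstate R m) :
  \tr (ketbra _ i *m reduced_density q s) = ((meas_prob i q s)%:C)%C.
Proof. by rewrite mxtrace_partial_trace meas_prob_ketE. Qed.

End PartialTrace.

Section Support.
Variables (R : realType) (m : nat) (PV : eqType).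
Local Open Scope ereal_scope.
Local Notation state := (cqstate R m PV).

Lemma sume_gt0_ex (I : eqType) (s : seq I) (F : I -> \bar R) :
  0 < \sum_(i <- s) F i -> exists2 i, i \in s & 0 < F i.
Proof.
move=> F0; apply: contrapT => N; move: F0; rewrite ltNge => /negP; apply.
rewrite big_seq; apply: sume_le0 => i si; rewrite leNgt.
by apply/negP => Fi; apply: N; exists i.
Qed.

Lemma point_dist_gt0 (t t' : state) : 0 < point_dist t t' -> t' = t.
Proof. by rewrite /point_dist; case: eqP => //; rewrite ltxx. Qed.

(** If [D t] and [K t t'] are never both positive, nonnegativity makes one of them zero for each
    [t], so every term of the sum vanishes. *)
Lemma extend_gt0 (K : state -> state -> \bar R) (D : state -> \bar R) t' :
  (forall t, 0 <= D t) -> (forall t, 0 <= K t t') ->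
  0 < extend K D t' -> exists t, 0 < D t /\ 0 < K t t'.
Proof.
move=> D0 K0; apply: contraPP => N; rewrite /extend esum1 ?ltxx // => t _.
have [-> |Dt] := eqVneq (D t) 0; first by rewrite mul0e.
have [-> |Kt] := eqVneq (K t t') 0; first by rewrite mule0.
by case: N; exists t; rewrite !lt0e Dt Kt D0 K0.
Qed.

Lemma restrict_gt0 (B : bexp PV) (D : state -> \bar R) t :
  0 < Defs.restrict B D t -> beval B t.1 /\ 0 < D t.
Proof. by rewrite /Defs.restrict; case: ifP => //; rewrite ltxx. Qed.

Lemma nneseries_gt0_ex (u : nat -> \bar R) :
  (forall n, 0 <= u n) -> 0 < \sum_(0 <= n <oo) u n -> exists n, 0 < u n.
Proof.
move=> u0; apply: contraPP => N; rewrite eseries0 ?ltxx // => n _ _.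
apply/eqP; rewrite eq_le u0 andbT leNgt; apply/negP => un.
by apply: N; exists n.
Qed.

End Support.

Section Assertions.
Context {R : realType} {m : nat} {PV LV : eqType}.
Local Notation state := (cqstate R m PV).
Local Notation assn := (assn R m PV LV).
Implicit Types (I : interp LV) (t : state) (f g : assn).

Lemma leval_of_aexp E I t : leval (lexp_of_aexp LV E) I t = aeval E t.1.
Proof. by elim: E => //= op E1 -> E2 ->. Qed.

Lemma leval_subst X E (e : lexp PV LV) I t :
  leval (lexp_subst X E e) I t = leval e I (cq_set X (aeval E t.1) t).
Proof.
elim: e => //= [Y|op e1 -> e2 ->] //.
by rewrite /update; case: ifP => // _; rewrite leval_of_aexp.
Qed.

(** The modalities are compatible with substitution because [cq_gate] and [cq_post] change only the
    quantum component and [cq_set] only the classical one, so they commute. *)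
Lemma sat_subst X E f I t :
  sat (assn_subst X E f) I t <-> sat f I (cq_set X (aeval E t.1) t).
Proof.
elim: f I t => //=.
- by move=> r e1 e2 I t; rewrite !leval_subst.
- by move=> f IH I t; rewrite IH.
- by move=> f IHf g IHg I t; rewrite IHf IHg.
- by move=> x f IH I t; split=> H n; apply/IH/H.
- by move=> i j f IH I t; rewrite (IH I (cq_post i j t)).
- by move=> fs IH I t; split=> H n; apply/IH/H.
Qed.

Lemma sat_of_bexp (B : bexp PV) I t : sat (assn_of_bexp R m LV B) I t <-> beval B t.1.
Proof.
elim: B => //= [r E1 E2|B IH|B1 IH1 B2 IH2].
- by rewrite !leval_of_aexp.
- by rewrite IH; split=> /negP.
- by rewrite IH1 IH2; split=> /andP.
Qed.

Lemma sat_foldl_and (T : eqType) (F : T -> assn) f (s : seq T) I t :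
  sat (foldl (@FAnd R m PV LV) f (map F s)) I t ->
  sat f I t /\ forall x, x \in s -> sat (F x) I t.
Proof.
elim: s f => [|y s IH] f //= /IH [[ft Fy] Fs]; split=> // x.
by rewrite inE => /predU1P [-> //|]; exact: Fs.
Qed.

Lemma sat_andSeq (T : eqType) (F : T -> assn) (s : seq T) I t :
  sat (FAndSeq (map F s)) I t -> forall x, x \in s -> sat (F x) I t.
Proof.
case: s => //= y s /sat_foldl_and [Fy Fs] x.
by rewrite inE => /predU1P [-> //|]; exact: Fs.
Qed.

Lemma sat_and f g I t : sat (FAnd f g) I t <-> sat f I t /\ sat g I t.
Proof. by []. Qed.

Lemma sat_or f g I t : sat (FOr f g) I t <-> sat f I t \/ sat g I t.
Proof.
split=> /= [H|[H|H] []//].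
(* [FOr] is a negated conjunction, so recovering the disjunction takes classical logic. *)
by apply: contrapT => N; apply: H; split=> H; apply: N; [left|right].
Qed.

(** The trace in [FProj] is the outcome probability cast to the complex numbers; taking real parts
    undoes the cast. *)
Lemma sat_proj i j I t :
  sat (FProj i j : assn) I t <-> meas_prob i j t.2 = 1%R.
Proof.
rewrite /= mxtrace_reduced_density; split=> [/(congr1 (@complex.Re R)) //|-> //].
Qed.

End Assertions.

Section Soundness.
Context {R : realType} {m : nat} {PV LV : eqType}.
Local Open Scope ereal_scope.
Local Notation state := (cqstate R m PV).
Local Notation assn := (assn R m PV LV).
Implicit Types (I : interp LV) (t : state) (f g : assn) (c : cmd R m PV).

(** Point distributions alone would not support the induction: in [Seq] the second command starts
    from whatever the first one produces. *)
Definition supp_sat f I (D : state -> \bar R) : Prop :=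
  (forall t, 0 <= D t) /\ (forall t, 0 < D t -> sat f I t).

Lemma supp_sat_restrict f B I D :
  supp_sat f I D -> supp_sat (FAnd f (assn_of_bexp R m LV B)) I (Defs.restrict B D).
Proof.
case=> D0 Df; split=> [|t /restrict_gt0 [Bt /Df ft]]; first exact: restrict_ge0.
by split=> //; apply/sat_of_bexp.
Qed.

Lemma supp_sat_extend f g I (K : state -> state -> \bar R) D :
  (forall t t', 0 <= K t t') ->
  (forall t t', sat f I t -> 0 < K t t' -> sat g I t') ->
  supp_sat f I D -> supp_sat g I (extend K D).
Proof.
move=> K0 Kfg [D0 Df]; split=> [|t']; first exact: extend_ge0.
by move=> /extend_gt0 [//|//|t [/Df ft]]; exact: Kfg.
Qed.

Lemma derivable_supp_sat f c g : derivable f c g ->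
  forall I D, supp_sat f I D -> supp_sat g I (denote c D).
Proof.
elim=> {f c g}.
- by [].
- move=> f X E I D; apply: supp_sat_extend => [t t'|t t' /sat_subst ft].
    exact: point_dist_ge0.
  by move=> /point_dist_gt0 ->.
- move=> f X l I D [D0 Df]; split; first exact: denote_ge0.
  (* Here [extend] sits inside the weighted sum; the weights are positive, so a positive term has a
     positive [extend] factor. *)
  move=> t' /= /sume_gt0_ex [ak akl].
  have /andP [a0 _] := allP (lottery_weights l) _ akl.
  rewrite pmule_rgt0 ?lte_fin // => /extend_gt0 [//|t|t].
    exact: point_dist_ge0.
  by case=> /Df /sat_andSeq /(_ _ akl) /sat_subst ft /point_dist_gt0 ->.
- by move=> f f1 f2 c1 c2 _ IH1 _ IH2 I D /IH1 /IH2.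
- move=> f g B c1 c2 _ IH1 _ IH2 I D Df /=.
  have [D1 g1] := IH1 _ _ (supp_sat_restrict f B I D Df).
  have [D2 g2] := IH2 _ _ (supp_sat_restrict f (BNot B) I D Df).
  split=> [t|t]; first exact: adde_ge0.
  have [/g1 //|n1] := ltP 0 (denote c1 (Defs.restrict B D) t).
  have [/g2 //|n2] := ltP 0 (denote c2 (Defs.restrict (BNot B) D) t).
  by rewrite ltNge => /negP []; exact: adde_le0.
- move=> f B c _ IH I D Df.
  (* The invariant holds on the support of every iterate of the guarded body. *)
  have Hi i : supp_sat f I (iter i (fun D' => denote c (Defs.restrict B D')) D).
    by elim: i => //= i; move/(supp_sat_restrict f B)/IH.
  (* [assn_of_bexp] of [BNot B] computes to the [FNot] in the postcondition. *)
  have Hr i := supp_sat_restrict f (BNot B) _ _ (Hi i).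
  split=> [t|t /=]; first by apply: denote_ge0; case: Df.
  move=> /nneseries_gt0_ex [n|i]; first by have [] := Hr n.
  by have [_] := Hr i; apply.
- move=> f g I D; apply: supp_sat_extend => [t t'|t t' ft].
    exact: point_dist_ge0.
  by move=> /point_dist_gt0 ->.
- move=> f X j I D.
  have p0 (i : 'I_2) t : 0 <= (meas_prob i j t.2)%:E.
    by rewrite lee_fin meas_prob_ket_ge0.
  apply: supp_sat_extend => [t t'|t t' /sat_and [/sat_or s0 /sat_or s1]].
    by apply: sume_ge0 => i _; rewrite mule_ge0 ?point_dist_ge0.
  move=> /sume_gt0_ex [i _].
  (* An outcome of probability 0 has weight 0, so the default value in [post_meas_ket] never reaches
     the support. *)
  have [->|pn0] := eqVneq (meas_prob i j t.2) 0%R; first by rewrite mul0e ltxx.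
  have pi0 : 0 < (meas_prob i j t.2)%:E by rewrite lt0e p0 eqe pn0.
  rewrite pmule_rgt0 // => /point_dist_gt0 ->; clear pi0.
  have psum := meas_prob_sum _ _ j t.2.
  (* The modal disjunct for outcome [i] gives [f] after the update. The other disjunct gives the
     opposite outcome probability 1, hence [i] probability 0, against [pn0]. *)
  have [i0|i1] : i = ord0 \/ i = ord_max.
    by case: (i) => [[|[|//]] ?]; [left|right]; exact: val_inj.
  + rewrite i0 in pn0 *; case: s0 => [[_ /sat_subst //]|/sat_proj p1].
    by move: psum pn0; rewrite p1 => /(canRL (addrK _)); rewrite subrr => ->; rewrite eqxx.
  + rewrite i1 in pn0 *; case: s1 => [[_ /sat_subst //]|/sat_proj p1].
    by move: psum pn0; rewrite p1 => /(canRL (addKr _)); rewrite addNr => ->; rewrite eqxx.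
- move=> f' f c g g' ff' _ IH gg' I D [D0 Df].
  have [//|D1 Dg] := IH I D; first by split=> // t /Df /ff'.
  by split=> // t /Dg /gg'.
Qed.

End Soundness.

Theorem theorem1 (R : realType) (m : nat) (PV LV : eqType)
    (phi psi : assn R m PV LV) (C : cmd R m PV) :
  derivable phi C psi -> valid phi C psi.
Proof.
move=> /derivable_supp_sat d I t phit.
have [|_ psiC] := d I (point_dist t); last exact: psiC.
by split=> [t'|t' /point_dist_gt0 ->]; first exact: point_dist_ge0.
Qed.
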